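(* Let $k\ge2$, $\beta>0$, $\lambda>0$, and $\mathcal A\subset\{1,\dots,p\}$ with $|\mathcal A|=k$. If \[ 2\lambda_n>\frac{g(\tau_n)}{G(\tau_n)}, \] where $G,g$ are the $N(0,1)$ cumulative distribution function and density, $\lambda_n=\lambda\sqrt n$ and $\tau_n=\sqrt n(\beta-\lambda)$, then $\frac{d}{dc}\psi_\lambda(c\mid k,\beta)\big|_{c=0}>0$. Hence there exists $c_\lambda>0$ with $\psi_\lambda(c_\lambda\mid k,\beta)>\psi_\lambda(0\mid k,\beta)$.
   Context: Fix integers $n\ge1$ and $2\le k<p$. $\mathbf J$ is an all-ones matrix; vector inequalities and absolute values are componentwise. For real $c$ with $-(k-1)^{-1}<c<1$ let $\mathbf C=(1-c)\mathbf I_p+c\mathbf J_p$. For $\mathcal A$ with complement $\mathcal I$ let $\mathbf C_{\mathcal A},\mathbf C_{\mathcal I},\mathbf C_{\mathcal I\mathcal A},\mathbf C_{\mathcal A\mathcal I}$ be the submatrices. For a sign vector $\boldsymbol z_{\mathcal A}\in\{-1,1\}^k$ with $\mathbf Z_{\mathcal A}=\mathrm{Diag}(\boldsymbol z_{\mathcal A})$ and $\boldsymbol\beta_{\mathcal A}$ with that sign vector: $P(S_\lambda\mid c,\boldsymbol\beta_{\mathcal A})=P(\boldsymbol u<\sqrt n\,\mathbf Z_{\mathcal A}\boldsymbol\beta_{\mathcal A})$ with $\boldsymbol u\sim N(\lambda\sqrt n\,\mathbf Z_{\mathcal A}\mathbf C_{\mathcal A}^{-1}\boldsymbol z_{\mathcal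 A},\ \mathbf Z_{\mathcal A}\mathbf C_{\mathcal A}^{-1}\mathbf Z_{\mathcal A})$; $P(I_\lambda\mid c,\boldsymbol z_{\mathcal A})=P(|\boldsymbol v|\le\lambda\sqrt n\mathbf 1)$ with $\boldsymbol v\sim N(\lambda\sqrt n\,\mathbf C_{\mathcal I\mathcal A}\mathbf C_{\mathcal A}^{-1}\boldsymbol z_{\mathcal A},\ \mathbf C_{\mathcal I}-\mathbf C_{\mathcal I\mathcal A}\mathbf C_{\mathcal A}^{-1}\mathbf C_{\mathcal A\mathcal I})$. The known-sign criterion is $\psi_\lambda(c\mid k,\beta)=P(S_\lambda\mid c,\boldsymbol\beta_{\mathcal A}=\beta\mathbf 1)\times P(I_\lambda\mid c,\boldsymbol z_{\mathcal A}=\mathbf 1)$ (its value does not depend on which $\mathcal A$ of size $k$ is used). *)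

(* Defs.v *)
From HB Require Import structures.
From mathcomp Require Import all_boot all_order all_algebra.
From mathcomp Require Import all_classical all_reals all_analysis.

Unset Strict Implicit.
Unset Printing Implicit Defensive.

Import Order.TTheory GRing.Theory Num.Def Num.Theory.
Import numFieldNormedType.Exports.

Local Open Scope classical_set_scope.
Local Open Scope ring_scope.

Section Defs.
Variable R : realType.

(** Iterated Lebesgue integral over R^m of a nonnegative function of the
    coordinate list (Tonelli: this is the integral w.r.t. Lebesgue measure
    on R^m for nonnegative measurable integrands). *)
Fixpoint iter_int (m : nat) (f : seq R -> \bar R) : \bar R :=
  match m with
  | 0 => f [::]
  | m'.+1 => (\int[@lebesgue_measure R]_x iter_int m' (fun s => f (x :: s)))%E
  end.

Definition col_of_seq (m : nat) (s : seq R) : 'cV[R]_m := \col_i nth 0 s i.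

Definition mvn_pdf (m : nat) (mu : 'cV[R]_m) (Sig : 'M[R]_m) (x : 'cV[R]_m) : R :=
  (Num.sqrt ((pi *+ 2) ^+ m * \det Sig))^-1 *
  expR (- (((x - mu)^T *m invmx Sig *m (x - mu)) 0 0) / 2).

Definition mvn_prob (m : nat) (mu : 'cV[R]_m) (Sig : 'M[R]_m)
    (S : 'cV[R]_m -> bool) : R :=
  fine (iter_int m (fun s => let x := col_of_seq m s in
                             ((S x)%:R * mvn_pdf m mu Sig x)%:E)).

Definition std_pdf (x : R) : R := normal_pdf 0 1 x.
Definition std_cdf (x : R) : R := fine (normal_prob 0 1 `]-oo, x]).

Definition Cmat (p : nat) (c : R) : 'M[R]_p := (1 - c)%:M + c *: const_mx 1.

Definition subm (p : nat) (M : 'M[R]_p) (X Y : {set 'I_p}) : 'M[R]_(#|X|, #|Y|) :=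
  \matrix_(i, j) M (enum_val i) (enum_val j).

Definition subv (p : nat) (b : 'cV[R]_p) (X : {set 'I_p}) : 'cV[R]_#|X| :=
  \col_i b (enum_val i) 0.

Definition PS (n p : nat) (lam c : R) (A : {set 'I_p}) (betaA : 'cV[R]_#|A|) : R :=
  let CA := subm p (Cmat p c) A A in
  let zA := map_mx (fun x => Num.sg x) betaA in
  let ZA := diag_mx zA^T in
  mvn_prob _ (lam * Num.sqrt n%:R *: (ZA *m invmx CA *m zA))
           (ZA *m invmx CA *m ZA)
           (fun u => [forall i, u i 0 < (Num.sqrt n%:R *: (ZA *m betaA)) i 0]).

Definition PI (n p : nat) (lam c : R) (A : {set 'I_p}) (zA : 'cV[R]_#|A|) : R :=
  let C := Cmat p c in
  let CA := subm p C A A in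
  let CI := subm p C (~: A) (~: A) in
  let CIA := subm p C (~: A) A in
  let CAI := subm p C A (~: A) in
  mvn_prob _ (lam * Num.sqrt n%:R *: (CIA *m invmx CA *m zA))
           (CI - CIA *m invmx CA *m CAI)
           (fun v => [forall i, `|v i 0| <= lam * Num.sqrt n%:R]).

(** Known-sign criterion psi_lambda(c | k, beta), computed with the
    support set A (|A| = k). *)
Definition psi (n p : nat) (lam beta : R) (A : {set 'I_p}) (c : R) : R :=
  PS n p lam c A (const_mx beta) * PI n p lam c A (const_mx 1).

End Defs.
Arguments psi {R} n p lam beta A c.
Arguments std_pdf {R} x.
Arguments std_cdf {R} x.

(* Main.v *)
(** The precision matrices of both Gaussian vectors have the form [a I + b J] and the
    events are products of intervals, so each of the two probabilities is an integral of
    [prod_i w(x_i) * exp T], where [w] is a truncated standard normal density and [T] is a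
    quadratic polynomial whose coefficients vanish at [c = 0].  Since
    [|exp T - 1 - T| <= T^2 exp |T|], the integrand lies between combinations of product
    functions that differ by [O(c^2)]; the integral is monotone, so the derivative at 0 is
    the integral of [prod_i w(x_i) * T'(0)], a polynomial in the moments of [w].
    For I the first moment vanishes by symmetry, hence the derivative is 0; for S the
    moments are [G] and [- g] and the derivative is
    [G^k * k (k - 1) / 2 * (g / G) * (2 lam_n - g / G)]. *)
Require Import Defs.
From HB Require Import structures.
From mathcomp Require Import all_boot all_order all_algebra.
From mathcomp Require Import ring lra.
From mathcomp Require Import all_classical all_reals all_analysis.
From mathcomp Require Import measurable_realfun.
Import Order.TTheory GRing.Theory Num.Def Num.Theory.
Import numFieldNormedType.Exports.
Local Open Scope classical_set_scope.
Local Open Scope ring_scope.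

(** * Iterated integrals: linearity, products and sandwiching *)

Section iterated_integrals.
Context {R : realType}.
Local Notation mu := (@lebesgue_measure R).

(* Unlike the library's [le_integral], no measurability is needed: the integral
   of a nonnegative function is a supremum over the simple functions below it. *)
Lemma le_integral_pointwise (f g : R -> \bar R) :
  (forall x, f x <= g x)%E -> (\int[mu]_x f x <= \int[mu]_x g x)%E.
Proof.
move=> fg; rewrite integralE [leRHS]integralE.
have mono (u v : R -> \bar R) : (forall x, 0 <= u x)%E ->
    (forall x, u x <= v x)%E -> (\int[mu]_x u x <= \int[mu]_x v x)%E.
  move=> u0 uv; rewrite !ge0_integralTE//; last first.
    by move=> x; exact: le_trans (u0 x) (uv x).
  apply: ereal_sup_le => _ [h hu <-]; exists h => //= x.
  exact: le_trans (hu x) (uv x).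
apply: leeB; apply: mono => // x.
  by rewrite !funeposE ge_max !le_max fg lexx orbT.
by rewrite !funenegE ge_max !le_max leeN2 fg lexx orbT.
Qed.

Lemma le_iter_int m (f g : seq R -> \bar R) :
  (forall s, f s <= g s)%E -> (iter_int R m f <= iter_int R m g)%E.
Proof.
elim: m f g => [|m IH] f g fg /=; first exact: fg.
by apply: le_integral_pointwise => x; apply: IH => s.
Qed.

(** A relation between an integrand and its value: each level exhibits the inner integrals as an
    explicit real function [g], defined at every [x] and integrable. Linearity and the product rule
    then follow by induction from their one-dimensional versions, without Tonelli. *)
Fixpoint iter_integrable m (f : seq R -> R) (v : R) : Prop :=
  match m with
  | 0 => f [::] = v
  | m'.+1 => exists g : R -> R,
      [/\ forall x, iter_integrable m' (fun s => f (x :: s)) (g x),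
          mu.-integrable setT (EFin \o g) & \int[mu]_x g x = v]
  end.

Lemma iter_integrableE m f v : iter_integrable m f v ->
  iter_int R m (EFin \o f) = v%:E.
Proof.
elim: m f v => [|m IH] f v /=; first by move->.
move=> [g [fg ig <-]].
under eq_integral => x _ do rewrite (IH _ _ (fg x)).
by rewrite /Rintegral fineK// integrable_fin_num.
Qed.

Lemma iter_integrableD m f1 f2 v1 v2 :
  iter_integrable m f1 v1 -> iter_integrable m f2 v2 ->
  iter_integrable m (fun s => f1 s + f2 s) (v1 + v2).
Proof.
elim: m f1 f2 v1 v2 => [|m IH] f1 f2 v1 v2 /=; first by move=> -> ->.
move=> [g1 [fg1 ig1 <-]] [g2 [fg2 ig2 <-]].
exists (fun x => g1 x + g2 x); split; first by move=> x; exact: IH.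
- rewrite (_ : _ \o _ = (EFin \o g1) \+ (EFin \o g2))%E//.
  exact: integrableD.
- exact: RintegralD.
Qed.

Lemma iter_integrableZ m k f v :
  iter_integrable m f v -> iter_integrable m (fun s => k * f s) (k * v).
Proof.
elim: m f v => [|m IH] f v /=; first by move=> ->.
move=> [g [fg ig <-]].
exists (fun x => k * g x); split; first by move=> x; exact: IH.
- rewrite (_ : _ \o _ = (fun x => k%:E * (EFin \o g) x))%E//.
  exact: integrableZl.
- exact: RintegralZl.
Qed.

Lemma eq_iter_integrable m f1 f2 v : f1 =1 f2 ->
  iter_integrable m f1 v -> iter_integrable m f2 v.
Proof. by move=> /funext ->. Qed.

Lemma iter_integrable0 m : iter_integrable m (fun=> 0) 0.
Proof.
elim: m => [//|m IH] /=; exists (fun=> 0); split => //.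
- exact: integrable0.
- by rewrite /Rintegral integral0.
Qed.

Lemma iter_integrable_sum (I : Type) (r : seq I) (P : pred I) m F V :
  (forall i, iter_integrable m (F i) (V i)) ->
  iter_integrable m (fun s => \sum_(i <- r | P i) F i s) (\sum_(i <- r | P i) V i).
Proof.
move=> FV; elim: r => [|i r IH].
  rewrite big_nil; apply: eq_iter_integrable (iter_integrable0 m) => s.
  by rewrite big_nil.
rewrite big_cons; case: ifPn => Pi; last first.
  by apply: eq_iter_integrable IH => s; rewrite big_cons (negbTE Pi).
apply: eq_iter_integrable (iter_integrableD _ _ _ _ _ (FV i) IH) => s.
by rewrite big_cons Pi.
Qed.

Lemma iter_integrable_prod m (phi : 'I_m -> R -> R) :
  (forall i, mu.-integrable setT (EFin \o phi i)) ->
  iter_integrable m (fun s => \prod_(i < m) phi i (nth 0 s i))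
    (\prod_(i < m) \int[mu]_x phi i x).
Proof.
elim: m phi => [|m IH] phi iphi /=; first by rewrite !big_ord0.
have {}IH := IH (fun i => phi (lift ord0 i)) (fun i => iphi _).
set V := \prod_(i < m) _ in IH.
exists (fun x => V * phi ord0 x); split => [x||].
- rewrite mulrC; apply: eq_iter_integrable (iter_integrableZ _ (phi ord0 x) _ _ IH) => s.
  by rewrite big_ord_recl.
- rewrite (_ : _ \o _ = (fun x => V%:E * (EFin \o phi ord0) x))%E//.
  exact: integrableZl.
- by rewrite RintegralZl// big_ord_recl mulrC.
Qed.

(** This is the only access to the integral of [f]: monotonicity bounds it in the extended reals by
    the known values of [f1] and [f2]. *)
Lemma iter_int_sandwich m (f f1 f2 : seq R -> R) v1 v2 :
  (forall s, f1 s <= f s <= f2 s) ->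
  iter_integrable m f1 v1 -> iter_integrable m f2 v2 ->
  v1 <= fine (iter_int R m (EFin \o f)) <= v2.
Proof.
move=> ff i1 i2.
have h1 : (v1%:E <= iter_int R m (EFin \o f))%E.
  rewrite -(iter_integrableE _ _ _ i1); apply: le_iter_int => s.
  by rewrite lee_fin; case/andP: (ff s).
have h2 : (iter_int R m (EFin \o f) <= v2%:E)%E.
  rewrite -(iter_integrableE _ _ _ i2); apply: le_iter_int => s.
  by rewrite lee_fin; case/andP: (ff s).
(* The finite bounds exclude both infinities, where [fine] would return its default value 0. *)
move: h1 h2; case: (iter_int _ _ _) => [r||]//.
by rewrite !lee_fin => -> ->.
Qed.

End iterated_integrals.

(** * Second-order remainders and their derivatives at 0 *)

Section second_order_estimates.
Context {R : realType}.
Local Notation mu := (@lebesgue_measure R).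

(** Everything comes from [1 + t <= expR t], used at [t] and [- t]: it gives [expR t - 1 - t >= 0]
    and [expR t - 1 <= t * expR t], hence [expR t - 1 - t <= t * (expR t - 1)]. The last product is
    then bounded according to the sign of [t]. *)
Lemma expR_taylor1_bound (t : R) : `|expR t - 1 - t| <= t ^+ 2 * expR `|t|.
Proof.
have h1 := expR_ge1Dx t; have h2 := expR_ge1Dx (- t).
have h3 : expR t * expR (- t) = 1 by rewrite -expRD subrr expR0.
have h4 := expR_gt0 t.
rewrite ger0_norm; last by lra.
have h5 : expR t - 1 <= t * expR t.
  have : expR t * (1 - t) <= expR t * expR (- t) by rewrite ler_pM2l.
  by rewrite h3; lra.
have [t0|t0] := leP 0 t.
  have := ler_wpM2l t0 h5; rewrite ger0_norm// expr2; lra.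
have h6 : t * (expR t - 1) <= t * t by rewrite ler_nM2l//; lra.
have : t * t * 1 <= t * t * expR `|t|.
  by rewrite ler_wpM2l -?expr2 ?sqr_ge0// -expR0 ler_expR.
rewrite expr2; lra.
Qed.

(** At 0 the bound forces [f 0 = 0], so the difference quotient of [f] is dominated in absolute
    value by that of [E], which tends to 0. *)
Lemma is_derive_squeeze (f E : R -> R) :
  (\forall c \near (0 : R), `|f c| <= E c) -> E 0 = 0 ->
  is_derive (0 : R) 1 E 0 -> is_derive (0 : R) 1 f 0.
Proof.
move=> fE E0 [dE dE0].
have f0 : f 0 = 0.
  by apply/eqP; rewrite -normr_le0 -[leRHS]E0; exact: (nbhs_singleton fE).
have cE : (fun h => h^-1 *: ((E \o shift 0) (h *: 1) - E 0)) @ (0 : R)^' --> (0 : R).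
  by rewrite -[X in _ --> X]dE0; exact: dE.
have cf : (fun h => h^-1 *: ((f \o shift 0) (h *: 1) - f 0)) @ (0 : R)^' --> (0 : R).
  apply/cvgr0Pnorm_lt => e e0.
  move/cvgr0Pnorm_lt : cE => /(_ _ e0) cEe.
  have fE' : \forall c \near (0 : R)^', `|f c| <= E c by exact: nbhs_dnbhs.
  near=> h.
  apply: (@le_lt_trans _ _ `|h^-1 *: ((E \o shift 0) (h *: 1) - E 0)|); last by near: h.
  rewrite !normrZ ler_wpM2l// f0 E0 !subr0 /= addr0 [h *: 1]mulr1.
  by apply: le_trans (ler_norm _); near: h.
apply: DeriveDef; last exact: cvg_lim cf.
by apply: cvgP; exact: cf.
Unshelve. all: by end_near. Qed.

Lemma is_derive_affine4 (s p q r : R -> R) (x v A B C D E ds dp dq dr : R) :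
  is_derive x v s ds -> is_derive x v p dp -> is_derive x v q dq -> is_derive x v r dr ->
  is_derive x v (fun c => A + (B * s c + C * q c + (D * p c + E * r c)))
    (B * ds + C * dq + (D * dp + E * dr)).
Proof.
move=> hs hp hq hr; rewrite -[X in is_derive _ _ _ X]add0r.
apply: is_deriveD; apply: is_deriveD; apply: is_deriveD; exact: is_deriveZ.
Qed.

(** Provides the bound [E] for [is_derive_squeeze]: squares of functions vanishing at [x] have zero
    derivative there. *)
Lemma is_derive_sum_sqr4 (s p q r : R -> R) (x v K ds dp dq dr : R) :
  is_derive x v s ds -> is_derive x v p dp -> is_derive x v q dq -> is_derive x v r dr ->
  s x = 0 -> p x = 0 -> q x = 0 -> r x = 0 ->
  is_derive x v (fun c => K * (s c ^+ 2 + p c ^+ 2 + q c ^+ 2 + r c ^+ 2)) 0.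
Proof.
move=> hs hp hq hr s0 p0 q0 r0.
rewrite -(scaler0 _ K); apply: (@is_deriveZ _ _ _ (s ^+ 2 + p ^+ 2 + q ^+ 2 + r ^+ 2)).
have sqr (f : R -> R) df : is_derive x v f df -> f x = 0 -> is_derive x v (f ^+ 2) 0.
  by move=> hf f0; apply: is_derive_eq; rewrite f0 expr1 mulr0 scale0r.
have := is_deriveD (is_deriveD (is_deriveD (sqr _ _ hs s0) (sqr _ _ hp p0))
  (sqr _ _ hq q0)) (sqr _ _ hr r0).
by rewrite !addr0.
Qed.

End second_order_estimates.

(** * Product weights perturbed by the exponential of a symmetric quadratic *)

Section gaussian_perturbation.
Context {R : realType} (m : nat) (m0 : R) (w : R -> R).
Local Notation mu := (@lebesgue_measure R).
Context (w_ge0 : forall x, 0 <= w x) (mw : measurable_fun setT w)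
  (iw : mu.-integrable setT (EFin \o (fun x => w x * expR ((x - m0) ^+ 2 / 4)))).

Definition moment (j : nat) : R := \int[mu]_x (w x * (x - m0) ^+ j).

(** The general permutation-invariant quadratic polynomial in the centred coordinates. The minus
    signs match a Gaussian exponent, so that [p] and [r] come from half the precision matrix. *)
Definition quad_perturb (s p q r : R) (x : seq R) : R :=
  s - p * (\sum_(i < m) (nth 0 x i - m0) ^+ 2) + q * (\sum_(i < m) (nth 0 x i - m0))
  - r * (\sum_(i < m) (nth 0 x i - m0)) ^+ 2.

Lemma measurable_subr_exp (a : R) j : measurable_fun setT (fun x : R => (x - a) ^+ j).
Proof. by apply: measurable_funX; exact: measurable_funB. Qed.

Lemma le_expR_sqr (y : R) : 4 + y ^+ 2 <= 4 * expR (y ^+ 2 / 4).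
Proof. have := expR_ge1Dx (y ^+ 2 / 4); lra. Qed.

(** With [y = x - m0], one has [|y| ^ j <= 4 + y ^ 2 <= 4 * expR (y ^ 2 / 4)] for [j <= 2], so [iw]
    dominates all the moments involved. *)
Lemma integrable_moment j : (j <= 2)%N ->
  mu.-integrable setT (EFin \o (fun x => w x * (x - m0) ^+ j)).
Proof.
move=> j2; pose g x := 4 * (w x * expR ((x - m0) ^+ 2 / 4)).
have ig : mu.-integrable setT (EFin \o g).
  rewrite (_ : _ \o _ =
    (fun x => 4%:E * (EFin \o (fun x => w x * expR ((x - m0) ^+ 2 / 4))%R) x))%E//.
  exact: integrableZl.
apply: le_integrable ig => //.
  by apply/measurable_EFinP/measurable_funM => //; exact: measurable_subr_exp.
move=> x _ /=; rewrite lee_fin /g normrM (ger0_norm (w_ge0 x)) mulrCA.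
rewrite [leRHS]ger0_norm; last by rewrite !mulr_ge0// expR_ge0.
rewrite ler_wpM2l//; apply: le_trans (le_expR_sqr _).
set y := x - m0; rewrite normrX.
have y2 : `|y| ^+ 2 = y ^+ 2 by rewrite -normrX ger0_norm// sqr_ge0.
have := normr_ge0 y.
by move: j j2 => [|[|[|]]]// _ y0; rewrite -y2 ?expr0 ?expr1; nra.
Qed.

(** Each monomial is written as a product over all coordinates, with exponent [(l == i)] or
    [(l == i) + (l == j)] at coordinate [l], so that [iter_integrable_prod] applies term by term. *)
Lemma quad_perturbE s p q r x :
  \prod_(l < m) w (nth 0 x l) * quad_perturb s p q r x =
  s * \prod_(l < m) (w (nth 0 x l) * (nth 0 x l - m0) ^+ 0) +
  q * (\sum_(i < m) \prod_(l < m) (w (nth 0 x l) * (nth 0 x l - m0) ^+ (l == i))) +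
  \sum_(i < m) \sum_(j < m) (- (p * (i == j)%:R + r)) *
    \prod_(l < m) (w (nth 0 x l) * (nth 0 x l - m0) ^+ ((l == i) + (l == j))).
Proof.
set W := \prod_(l < m) w (nth 0 x l).
pose y i := nth 0 x i - m0.
have pow1 (i : 'I_m) : \prod_(l < m) y l ^+ (l == i) = y i.
  rewrite (bigD1 i)//= eqxx expr1 big1 ?mulr1// => l /negbTE ->; exact: expr0.
have e0 : \prod_(l < m) (w (nth 0 x l) * (nth 0 x l - m0) ^+ 0) = W.
  by apply: eq_bigr => l _; rewrite expr0 mulr1.
have e1 i : \prod_(l < m) (w (nth 0 x l) * (nth 0 x l - m0) ^+ (l == i)) = W * y i.
  by rewrite big_split/= pow1.
have e2 i j : \prod_(l < m) (w (nth 0 x l) * (nth 0 x l - m0) ^+ ((l == i) + (l == j)))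
    = W * (y i * y j).
  rewrite big_split/=; congr (_ * _).
  by under eq_bigr do rewrite exprD; rewrite big_split/= !pow1.
rewrite e0; under eq_bigr do rewrite e1.
under [X in _ = _ + X]eq_bigr => i _ do under eq_bigr do rewrite e2.
rewrite -mulr_sumr /quad_perturb -/(y _).
have -> : \sum_(i < m) \sum_(j < m) (- (p * (i == j)%:R + r)) * (W * (y i * y j)) =
   W * (- p * \sum_(i < m) y i ^+ 2 - r * (\sum_(i < m) y i) ^+ 2).
  rewrite expr2 mulr_suml !mulr_sumr -sumrB mulr_sumr; apply: eq_bigr => i _.
  under eq_bigr do rewrite opprD mulrDl; rewrite big_split/= mulrBr; congr (_ + _).
    rewrite (bigD1 i)//= eqxx mulr1 big1 ?addr0 => [|j ji].
      by rewrite expr2; ring.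
    by rewrite eq_sym (negbTE ji) mulr0 oppr0 mul0r.
  by rewrite !mulr_sumr -sumrN; apply: eq_bigr => j _; ring.
by rewrite /y; ring.
Qed.

(** The integral of the weight times [1 + T], where [T] is [quad_perturb]: the first-order
    expansion, affine in the four coefficients. *)
Definition perturb_linear (s p q r : R) : R :=
  moment 0 ^+ m + (s * moment 0 ^+ m +
  q * (\sum_(i < m) \prod_(l < m) moment (l == i)) +
  \sum_(i < m) \sum_(j < m) (- (p * (i == j)%:R + r)) *
    \prod_(l < m) moment ((l == i) + (l == j))).

Lemma iter_integrable_perturb s p q r :
  iter_integrable m (fun x => \prod_(l < m) w (nth 0 x l) * (1 + quad_perturb s p q r x))
    (perturb_linear s p q r).
Proof.
have mom0 : moment 0 ^+ m = \prod_(l < m) moment 0.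
  by rewrite prodr_const card_ord.
have int0 : iter_integrable m
    (fun x => \prod_(l < m) (w (nth 0 x l) * (nth 0 x l - m0) ^+ 0)) (moment 0 ^+ m).
  rewrite mom0.
  by apply: (iter_integrable_prod _ (fun=> fun y => w y * (y - m0) ^+ 0)) => i;
    exact: integrable_moment.
pose b x := \prod_(l < m) (w (nth 0 x l) * (nth 0 x l - m0) ^+ 0) +
  (s * \prod_(l < m) (w (nth 0 x l) * (nth 0 x l - m0) ^+ 0) +
  q * (\sum_(i < m) \prod_(l < m) (w (nth 0 x l) * (nth 0 x l - m0) ^+ (l == i))) +
  \sum_(i < m) \sum_(j < m) (- (p * (i == j)%:R + r)) *
    \prod_(l < m) (w (nth 0 x l) * (nth 0 x l - m0) ^+ ((l == i) + (l == j)))).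
apply: (eq_iter_integrable _ b) => [x|].
  rewrite [RHS]mulrDr mulr1 quad_perturbE /b; congr (_ + _).
  by apply: eq_bigr => l _; rewrite expr0 mulr1.
apply: iter_integrableD => //; apply: iter_integrableD; first apply: iter_integrableD.
- exact: iter_integrableZ.
- apply: iter_integrableZ; apply: iter_integrable_sum => i.
  apply: (iter_integrable_prod _ (fun l => fun y => w y * (y - m0) ^+ (l == i))) => l.
  by apply: integrable_moment; case: (l == i).
- apply: iter_integrable_sum => i; apply: iter_integrable_sum => j.
  apply: iter_integrableZ.
  apply: (iter_integrable_prod _
    (fun l => fun y => w y * (y - m0) ^+ ((l == i) + (l == j)))) => l.
  by apply: integrable_moment; case: (l == i); case: (l == j).
Qed.

Lemma quad_perturb_bound s p q r x :
  `|quad_perturb s p q r x| <= (`|s| + `|p| + `|q| + `|r|) * (m%:R + 1) *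
     (1 + \sum_(i < m) (nth 0 x i - m0) ^+ 2).
Proof.
rewrite /quad_perturb.
set Q := \sum_(i < m) (nth 0 x i - m0) ^+ 2; set S := \sum_(i < m) (nth 0 x i - m0).
have Q0 : 0 <= Q by apply: sumr_ge0 => i _; exact: sqr_ge0.
have S1 : `|S| <= m%:R + Q.
  apply: (le_trans (ler_norm_sum _ _ _)).
  rewrite (_ : m%:R + Q = \sum_(i < m) (1 + (nth 0 x i - m0) ^+ 2)); last first.
    by rewrite big_split/= sumr_const card_ord.
  apply: ler_sum => i _; have := normr_ge0 (nth 0 x i - m0).
  rewrite -(ger0_norm (sqr_ge0 (nth 0 x i - m0))) normrX.
  by move: `|_| => a a0; nra.
(* Cauchy-Schwarz, obtained by summing [y_i * y_j <= (y_i ^ 2 + y_j ^ 2) / 2] over all pairs. *)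
have S2 : S ^+ 2 <= m%:R * Q.
  rewrite expr2 /S mulr_suml.
  have -> : m%:R * Q = \sum_(i < m) \sum_(j < m)
      (((nth 0 x i - m0) ^+ 2 + (nth 0 x j - m0) ^+ 2) / 2).
    under eq_bigr do rewrite -mulr_suml big_split/= sumr_const card_ord -/Q.
    rewrite -mulr_suml big_split/= sumr_const card_ord sumrMnl -/Q.
    rewrite -[Q *+ m]mulr_natl; generalize (m%:R : R) Q => a b; by field.
  apply: ler_sum => i _; rewrite mulr_sumr; apply: ler_sum => j _.
  by have := sqr_ge0 (nth 0 x i - nth 0 x j); nra.
have m0' : 0 <= m%:R :> R by [].
have h1 : `|s| <= `|s| * ((m%:R + 1) * (1 + Q)) by rewrite ler_peMr//; nra.
have h2 : `|p * Q| <= `|p| * ((m%:R + 1) * (1 + Q)).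
  by rewrite normrM (ger0_norm Q0) ler_wpM2l//; nra.
have h3 : `|q * S| <= `|q| * ((m%:R + 1) * (1 + Q)).
  by rewrite normrM ler_wpM2l//; nra.
have h4 : `|r * S ^+ 2| <= `|r| * ((m%:R + 1) * (1 + Q)).
  by rewrite normrM (ger0_norm (sqr_ge0 S)) ler_wpM2l//; nra.
have := ler_normB (s - p * Q + q * S) (r * S ^+ 2).
have := ler_normD (s - p * Q) (q * S); have := ler_normB s (p * Q).
lra.
Qed.

(** In [T ^ 2 * expR |T|], smallness gives [|T| <= (1 + Q) / 8], while
    [(1 + Q) ^ 2 <= 256 * expR ((1 + Q) / 8)] absorbs the polynomial factor. The two exponentials
    multiply to [expR (1 / 4) * expR (Q / 4)], which is exactly the growth that [iw] integrates. The
    constant 1024 is 256 times the 4 from [e ^ 2 <= 4 * (s ^ 2 + p ^ 2 + q ^ 2 + r ^ 2)]. *)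
Lemma perturb_remainder_bound s p q r x :
  (`|s| + `|p| + `|q| + `|r|) * (m%:R + 1) <= 1 / 8 ->
  `|expR (quad_perturb s p q r x) - 1 - quad_perturb s p q r x| <=
  1024 * (m%:R + 1) ^+ 2 * expR (1 / 4) * (s ^+ 2 + p ^+ 2 + q ^+ 2 + r ^+ 2) *
    \prod_(i < m) expR ((nth 0 x i - m0) ^+ 2 / 4).
Proof.
move=> small; apply: (le_trans (expR_taylor1_bound _)).
have := quad_perturb_bound s p q r x; set T := quad_perturb _ _ _ _ _ => bT.
rewrite -expR_sum -mulr_suml.
set Q := \sum_(i < m) _ in bT *.
have Q0 : 0 <= Q by apply: sumr_ge0 => i _; exact: sqr_ge0.
set e := `|s| + _ + _ + _ in bT small.
have e0 : 0 <= e by rewrite !addr_ge0.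
have m1 : 0 <= m%:R + 1 :> R by rewrite addr_ge0.
have e2 : e ^+ 2 <= 4 * (s ^+ 2 + p ^+ 2 + q ^+ 2 + r ^+ 2).
  rewrite /e -[s ^+ 2]real_normK ?num_real// -[p ^+ 2]real_normK ?num_real//.
  rewrite -[q ^+ 2]real_normK ?num_real// -[r ^+ 2]real_normK ?num_real//.
  have := sqr_ge0 (`|s| - `|p|); have := sqr_ge0 (`|s| - `|q|).
  have := sqr_ge0 (`|s| - `|r|); have := sqr_ge0 (`|p| - `|q|).
  have := sqr_ge0 (`|p| - `|r|); have := sqr_ge0 (`|q| - `|r|).
  nra.
have W1 : (1 + Q) ^+ 2 <= 256 * expR ((1 + Q) / 8).
  have h := expR_ge1Dx ((1 + Q) / 16).
  have -> : (1 + Q) / 8 = (1 + Q) / 16 + (1 + Q) / 16 by field.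
  by rewrite expRD; nra.
have T2 : T ^+ 2 <= (e * (m%:R + 1)) ^+ 2 * (1 + Q) ^+ 2.
  by rewrite -exprMn -real_normK ?num_real// lerXn2r ?nnegrE ?mulr_ge0 ?addr_ge0.
have eT : expR `|T| <= expR ((1 + Q) / 8).
  by rewrite ler_expR; apply: (le_trans bT); nra.
have eW : expR ((1 + Q) / 8) * expR ((1 + Q) / 8) = expR (1 / 4) * expR (Q / 4).
  by rewrite -!expRD; congr expR; field.
apply: (@le_trans _ _ ((e * (m%:R + 1)) ^+ 2 * (1 + Q) ^+ 2 * expR ((1 + Q) / 8))).
  by rewrite ler_pM ?sqr_ge0 ?expR_ge0.
apply: (@le_trans _ _ ((e * (m%:R + 1)) ^+ 2 * (256 * expR ((1 + Q) / 8)) *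
    expR ((1 + Q) / 8))).
  by rewrite ler_wpM2r ?expR_ge0// ler_wpM2l ?sqr_ge0.
rewrite [leLHS](_ : _ = e ^+ 2 * (256 * (m%:R + 1) ^+ 2 *
    (expR ((1 + Q) / 8) * expR ((1 + Q) / 8)))); last by rewrite exprMn; ring.
rewrite eW [leRHS](_ : _ = (4 * (s ^+ 2 + p ^+ 2 + q ^+ 2 + r ^+ 2)) *
    (256 * (m%:R + 1) ^+ 2 * (expR (1 / 4) * expR (Q / 4)))); last by ring.
by rewrite ler_wpM2r// !mulr_ge0 ?expR_ge0 ?sqr_ge0.
Qed.

Definition perturbed_integral (s p q r : R) : R :=
  fine (iter_int R m (EFin \o
    (fun x => \prod_(l < m) w (nth 0 x l) * expR (quad_perturb s p q r x)))).

(** The integrand lies between [f - K * h] and [f + K * h], where [f] is the first-order integrand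
    and [h] a product function. Both ends have explicit iterated integrals. *)
Lemma perturbed_integral_expansion : exists K : R, forall s p q r : R,
  (`|s| + `|p| + `|q| + `|r|) * (m%:R + 1) <= 1 / 8 ->
  `|perturbed_integral s p q r - perturb_linear s p q r| <=
  K * (s ^+ 2 + p ^+ 2 + q ^+ 2 + r ^+ 2).
Proof.
pose h x := \prod_(i < m) (w (nth 0 x i) * expR ((nth 0 x i - m0) ^+ 2 / 4)).
pose I := \prod_(i < m) \int[mu]_x (w x * expR ((x - m0) ^+ 2 / 4)).
have ih : iter_integrable m h I.
  by apply: (iter_integrable_prod _ (fun=> fun x => w x * expR ((x - m0) ^+ 2 / 4))).
exists (1024 * (m%:R + 1) ^+ 2 * expR (1 / 4) * I) => s p q r small.
set D := s ^+ 2 + _ + _ + _.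
pose K := 1024 * (m%:R + 1) ^+ 2 * expR (1 / 4) * D : R.
pose f x := \prod_(l < m) w (nth 0 x l) * (1 + quad_perturb s p q r x).
have : perturb_linear s p q r + (- K) * I <= perturbed_integral s p q r <=
       perturb_linear s p q r + K * I.
  apply: (iter_int_sandwich m _ (fun x => f x + (- K) * h x) (fun x => f x + K * h x)).
  - move=> x.
    have W0 : 0 <= \prod_(l < m) w (nth 0 x l) by apply: prodr_ge0 => l _.
    have := perturb_remainder_bound s p q r x small; rewrite -/D -/K.
    move/(ler_wpM2l W0).
    rewrite mulrCA -big_split/= -/(h x) -{1}(ger0_norm W0) -normrM ler_norml /f.
    by move=> /andP[u1 u2]; apply/andP; split; lra.
  - by apply: iter_integrableD; [exact: iter_integrable_perturb|exact: iter_integrableZ].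
  - by apply: iter_integrableD; [exact: iter_integrable_perturb|exact: iter_integrableZ].
rewrite ler_norml (_ : _ * I * D = K * I); last by rewrite /K; ring.
lra.
Qed.

(** With zero coefficients the error bound is 0, so the expansion is exact. *)
Lemma perturbed_integral0 : perturbed_integral 0 0 0 0 = moment 0 ^+ m.
Proof.
have [K /(_ 0 0 0 0)] := perturbed_integral_expansion.
rewrite !normr0 !addr0 mul0r => /(_ _)/wrap[]; first by lra.
rewrite expr0n/= !addr0 mulr0 normr_le0 subr_eq0 => /eqP ->.
rewrite /perturb_linear !mul0r !add0r big1 ?addr0// => i _; rewrite big1// => j _.
by rewrite mul0r addr0 oppr0 mul0r.
Qed.

Lemma is_derive0_near_small (f : R -> R) (df e : R) : is_derive (0 : R) 1 f df ->
  f 0 = 0 -> 0 < e -> \forall c \near (0 : R), `|f c| < e.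
Proof.
move=> [/derivable1_diffP/differentiable_continuous cf _] f0 e0.
by move: cf => /cvgrPdist_lt/(_ _ e0); rewrite f0; apply: filterS => c; rewrite sub0r normrN.
Qed.

(** The function splits into [lin], affine in the coefficients, and [rem], which is bounded by a sum
    of squares near 0 and so has zero derivative. Subtracting [moment 0 ^+ m] removes the constant
    term of [perturb_linear]. *)
Lemma is_derive_perturbed_integral (s p q r : R -> R) (ds dp dq dr : R) :
  is_derive (0 : R) 1 s ds -> is_derive (0 : R) 1 p dp ->
  is_derive (0 : R) 1 q dq -> is_derive (0 : R) 1 r dr ->
  s 0 = 0 -> p 0 = 0 -> q 0 = 0 -> r 0 = 0 ->
  is_derive (0 : R) 1 (fun c => perturbed_integral (s c) (p c) (q c) (r c))
    (perturb_linear ds dp dq dr - moment 0 ^+ m).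
Proof.
move=> hs hp hq hr s0 p0 q0 r0.
pose B := moment 0 ^+ m.
pose C := \sum_(i < m) \prod_(l < m) moment (l == i).
pose P i j := \prod_(l < m) moment ((l == i) + (l == j)).
pose D := - \sum_(i < m) \sum_(j < m) (i == j)%:R * P i j.
pose E := - \sum_(i < m) \sum_(j < m) P i j.
have linE a b c d : perturb_linear a b c d = B + (B * a + C * c + (D * b + E * d)).
  rewrite /perturb_linear -/B -/C (mulrC a) (mulrC c); congr (_ + (_ + _)).
  rewrite /D /E !mulNr -opprD !mulr_suml -big_split/= -sumrN.
  apply: eq_bigr => i _; rewrite !mulr_suml -big_split/= -sumrN; apply: eq_bigr => j _.
  by rewrite /P; ring.
have [K HK] := perturbed_integral_expansion.
pose lin c := B + (B * s c + C * q c + (D * p c + E * r c)).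
have dlin : is_derive (0 : R) 1 lin (perturb_linear ds dp dq dr - B).
  by rewrite linE addrC addKr; exact: is_derive_affine4.
pose rem c := perturbed_integral (s c) (p c) (q c) (r c) - lin c.
have drem : is_derive (0 : R) 1 rem 0.
  pose G c := K * (s c ^+ 2 + p c ^+ 2 + q c ^+ 2 + r c ^+ 2).
  apply: (@is_derive_squeeze _ _ G).
  (* Each of the four coefficients gets a quarter of the allowance [1 / 8]. *)
  - have e0 : 0 < 1 / 32 / (m%:R + 1) :> R by rewrite divr_gt0// ltr_wpDl.
    near=> c; rewrite /rem /lin -linE; apply: HK.
    rewrite -ler_pdivlMr ?ltr_wpDl//.
    have : `|s c| < 1 / 32 / (m%:R + 1) by near: c; exact: is_derive0_near_small hs s0 e0.
    have : `|p c| < 1 / 32 / (m%:R + 1) by near: c; exact: is_derive0_near_small hp p0 e0.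
    have : `|q c| < 1 / 32 / (m%:R + 1) by near: c; exact: is_derive0_near_small hq q0 e0.
    have : `|r c| < 1 / 32 / (m%:R + 1) by near: c; exact: is_derive0_near_small hr r0 e0.
    lra.
  - by rewrite /G s0 p0 q0 r0 expr0n/= !addr0 mulr0.
  - exact: is_derive_sum_sqr4 hs hp hq hr s0 p0 q0 r0.
rewrite (_ : (fun c => _) = lin + rem); last first.
  by apply/funext => c; rewrite !fctE /rem addrC subrK.
by rewrite -[X in is_derive _ _ _ X]addr0; exact: is_deriveD.
Unshelve. all: by end_near. Qed.

End gaussian_perturbation.

(** * Products, inverses, determinants and quadratic forms of [a I + b J] *)

Section equicorrelated_matrices.
Context {R : realType}.

Lemma mul_const_mx1 m k n :
  (const_mx 1 : 'M[R]_(m, k)) *m (const_mx 1 : 'M[R]_(k, n)) = k%:R *: const_mx 1.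
Proof.
apply/matrixP => i j; rewrite !mxE mulr1.
under eq_bigr do rewrite !mxE mulr1.
by rewrite sumr_const card_ord.
Qed.

Lemma mul_equicor m (a b a' b' : R) :
  (a%:M + b *: const_mx 1) *m (a'%:M + b' *: const_mx 1) =
  (a * a')%:M + (a * b' + b * a' + b * b' * m%:R) *: const_mx 1 :> 'M[R]_m.
Proof.
rewrite mulmxDl !mulmxDr -scalar_mxM mul_scalar_mx mul_mx_scalar.
rewrite -scalemxAl -scalemxAr mul_const_mx1 !scalerA -addrA -!scalerDl.
by congr (_ + _ *: _); ring.
Qed.

Lemma mul_equicor_const m n (a b : R) :
  (a%:M + b *: const_mx 1) *m const_mx 1 = (a + b * m%:R) *: const_mx 1 :> 'M[R]_(m, n).
Proof.
by rewrite mulmxDl mul_scalar_mx -scalemxAl mul_const_mx1 scalerA -scalerDl.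
Qed.

Lemma invmx_right n (A B : 'M[R]_n) : A *m B = 1%:M -> invmx A = B.
Proof.
move=> AB; have [uA _] := mulmx1_unit AB.
by rewrite -[invmx A]mulmx1 -AB mulKmx.
Qed.

Lemma invmx_equicor m (a b a' b' : R) : a * a' = 1 ->
  a * b' + b * a' + b * b' * m%:R = 0 ->
  invmx (a%:M + b *: const_mx 1 : 'M[R]_m) = a'%:M + b' *: const_mx 1.
Proof.
by move=> h1 h2; apply: invmx_right; rewrite mul_equicor h1 h2 scale0r addr0.
Qed.

(* Both Schur complements of [[a I, -b 1], [1^T, 1]]. *)
Lemma det_equicor m (a b : R) : a != 0 ->
  \det (a%:M + b *: const_mx 1 : 'M[R]_m) = a ^+ m * (1 + m%:R * b / a).
Proof.
move=> a0.
pose u : 'M[R]_(m, 1) := (- b) *: const_mx 1; pose v : 'M[R]_(1, m) := const_mx 1.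
pose M := block_mx a%:M u v 1%:M.
have e1 : M *m block_mx 1%:M 0 (- v) 1%:M = block_mx (a%:M + b *: const_mx 1) u 0 1%:M.
  rewrite mulmx_block !mulmx1 !mulmx0 !mul1mx !add0r mulmxN subrr.
  by rewrite /u /v -scalemxAl mul_const_mx1 scale1r scaleNr opprK.
have e2 : block_mx 1%:M 0 (- a^-1 *: v) 1%:M *m M =
    block_mx a%:M u 0 (1 + m%:R * b / a)%:M.
  rewrite mulmx_block !mul1mx !mul0mx !addr0 mul_mx_scalar scalerA mulrN divff//.
  rewrite scaleN1r addNr /u /v -scalemxAl -scalemxAr mul_const_mx1 !scalerA.
  congr block_mx; apply/matrixP => i j; rewrite !mxE !ord1 eqxx/= mulr1 mulr1n.
  by field.
have d1 : \det M = \det (a%:M + b *: const_mx 1 : 'M[R]_m).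
  by have := congr1 determinant e1; rewrite det_mulmx det_lblock det_ublock !det1 !mulr1.
have d2 : \det M = a ^+ m * (1 + m%:R * b / a).
  have := congr1 determinant e2.
  by rewrite det_mulmx det_lblock det_ublock !det1 !mul1r det_scalar det_scalar1.
by rewrite -d1.
Qed.

Lemma mvn_quadratic_form m (a b t : R) (x : 'cV[R]_m) :
  ((x - const_mx t)^T *m (a%:M + b *: const_mx 1) *m (x - const_mx t)) 0 0 =
  a * (\sum_i (x i 0 - t) ^+ 2) + b * (\sum_i (x i 0 - t)) ^+ 2.
Proof.
have -> : (x - const_mx t)^T *m (a%:M + b *: const_mx 1) =
    a *: (x - const_mx t)^T + (b * \sum_i (x i 0 - t)) *: const_mx 1.
  rewrite mulmxDr mul_mx_scalar -scalemxAr; congr (_ + _).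
  rewrite -scalerA; congr (_ *: _); apply/matrixP => i j; rewrite !mxE mulr1.
  by apply: eq_bigr => l _; rewrite !mxE mulr1 ord1.
set S := \sum_i (x i 0 - t); rewrite !mxE.
have -> : b * S ^+ 2 = \sum_i b * S * (x i 0 - t) by rewrite -mulr_sumr expr2 mulrA.
rewrite mulr_sumr -big_split/=; apply: eq_bigr => i _.
by rewrite !mxE; ring.
Qed.

End equicorrelated_matrices.

(** * Multivariate normal probabilities as perturbed product integrals *)

Section mvn_as_perturbation.
Context {R : realType}.

Lemma expR_half_ln (d : R) : 0 < d -> expR (- ln d / 2) = (Num.sqrt d)^-1.
Proof.
move=> d0; have e : d = expR (ln d / 2) ^+ 2.
  by rewrite expr2 -expRD -[LHS]lnK ?posrE//; congr expR; field.
by rewrite mulNr expRN [in RHS]e sqrtr_sqr ger0_norm// expR_ge0.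
Qed.

Lemma sqrtrXn (a : R) m : 0 <= a -> Num.sqrt (a ^+ m) = Num.sqrt a ^+ m.
Proof.
move=> a0; elim: m => [|m IH]; first by rewrite !expr0 sqrtr1.
by rewrite !exprS sqrtrM// IH.
Qed.

(* The normalising factor [d ^ (-1/2)] is moved into the constant term of the exponent. *)
Lemma mvn_probE m (t m0 a b d : R) (Sig : 'M[R]_m) (om : R -> bool) :
  0 < d -> \det Sig = d -> invmx Sig = a%:M + b *: const_mx 1 ->
  mvn_prob R m (const_mx t) Sig (fun x => [forall i, om (x i 0)]) =
  perturbed_integral m m0 (fun x => (om x)%:R * normal_pdf m0 1 x)
    (- ln d / 2 - (a * m%:R + b * m%:R ^+ 2) * (t - m0) ^+ 2 / 2) ((a - 1) / 2)
    ((a + b * m%:R) * (t - m0)) (b / 2).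
Proof.
move=> d0 detS invS; rewrite /mvn_prob /perturbed_integral; congr (fine (iter_int R m _)).
apply/funext => x /=; congr EFin.
set X := col_of_seq R m x.
have Xi i : X i 0 = nth 0 x i by rewrite mxE.
rewrite big_split/= -[RHS]mulrA.
(* The indicator of a product event factors into coordinate indicators, which join the
   one-dimensional weights. *)
have -> : [forall i, om (X i 0)]%:R = \prod_(l < m) (om (nth 0 x l))%:R :> R.
  case: forallP => [h|h].
    by rewrite big1// => i _; rewrite -Xi h.
  have [i /negbTE hi] : exists i, ~~ om (X i 0).
    by apply/existsP; rewrite -negb_forall; apply/forallP.
  by rewrite (bigD1 i)//= -Xi hi mul0r.
congr (_ * _); rewrite /mvn_pdf detS invS mvn_quadratic_form.
have -> : \prod_(l < m) normal_pdf m0 1 (nth 0 x l) =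
    (Num.sqrt (pi *+ 2) ^+ m)^-1 * expR (- (\sum_(l < m) (nth 0 x l - m0) ^+ 2) / 2).
  under eq_bigr do rewrite normal_pdfE ?oner_eq0//.
  rewrite big_split/= prodr_const card_ord /normal_peak expr1n mul1r -exprVn.
  rewrite /normal_fun -expR_sum expr1n; congr (_ * expR _).
  by rewrite -mulr_suml sumrN.
have pi2 : 0 <= pi *+ 2 :> R by rewrite mulrn_wge0 ?pi_ge0.
have -> : Num.sqrt ((pi *+ 2) ^+ m * d) = Num.sqrt (pi *+ 2) ^+ m * Num.sqrt d.
  by rewrite sqrtrM ?exprn_ge0// sqrtrXn.
rewrite invfM -expR_half_ln// -!mulrA -!expRD; congr (_ * expR _).
rewrite /quad_perturb.
have mE (y : R) : m%:R * y = \sum_(i < m) y by rewrite sumr_const card_ord mulr_natl.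
(* Recentring from the moving mean [t] to the fixed centre [m0] produces the linear coefficient and
   the part of the constant term in [(t - m0) ^ 2]. *)
have e1 : \sum_i (X i 0 - t) = \sum_(i < m) (nth 0 x i - m0) - m%:R * (t - m0).
  rewrite mE -sumrB.
  by apply: eq_bigr => i _; rewrite Xi; ring.
have e2 : \sum_i (X i 0 - t) ^+ 2 = \sum_(i < m) (nth 0 x i - m0) ^+ 2
    - 2 * (t - m0) * \sum_(i < m) (nth 0 x i - m0) + m%:R * (t - m0) ^+ 2.
  rewrite mE mulr_sumr -sumrB -big_split/=.
  by apply: eq_bigr => i _; rewrite Xi; ring.
rewrite e1 e2.
generalize (\sum_(i < m) (nth 0 x i - m0)) (\sum_(i < m) (nth 0 x i - m0) ^+ 2) => S Q.
by field.
Qed.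

End mvn_as_perturbation.

(** * Moments of truncated unit-variance normal densities *)

Section gaussian_moments.
Context {R : realType}.
Local Notation mu := (@lebesgue_measure R).

Lemma normal_pdf1E (m0 x : R) :
  normal_pdf m0 1 x = normal_peak 1 * expR (- (x - m0) ^+ 2 / 2).
Proof. by rewrite normal_pdfE ?oner_eq0// /normal_fun expr1n. Qed.

Lemma normal_pdf1_shift (m0 x : R) : normal_pdf m0 1 x = std_pdf (x - m0).
Proof. by rewrite /std_pdf !normal_pdf1E subr0. Qed.

Lemma normal_pdf1_gt0 (m0 x : R) : 0 < normal_pdf m0 1 x.
Proof. by rewrite normal_pdf1E mulr_gt0 ?expR_gt0// normal_peak_gt0 ?oner_eq0. Qed.

Lemma integrable_truncated_normal (m0 : R) (om : R -> bool) :
  measurable_fun setT (fun x => (om x)%:R : R) ->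
  mu.-integrable setT (EFin \o (fun x => (om x)%:R * normal_pdf m0 1 x *
     expR ((x - m0) ^+ 2 / 4))).
Proof.
move=> mom.
(* The extra factor turns [expR (- y ^ 2 / 2)] into [expR (- y ^ 2 / 4)], a normal density of
   variance 2 up to the ratio of the peaks. *)
pose C : R := normal_peak 1 / normal_peak (Num.sqrt 2).
have s2 : Num.sqrt 2 != 0 :> R by rewrite gt_eqF// sqrtr_gt0.
have iC : mu.-integrable setT (EFin \o (fun x => C * normal_pdf m0 (Num.sqrt 2) x)).
  rewrite (_ : _ \o _ = (fun x => C%:E * (normal_pdf m0 (Num.sqrt 2) x)%:E))%E//.
  by apply: integrableZl => //; exact: integrable_normal_pdf.
apply: le_integrable iC => //.
  apply/measurable_EFinP; apply: measurable_funM.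
    by apply: measurable_funM => //; exact: measurable_normal_pdf.
  apply: measurableT_comp => //; apply: measurable_funM => //.
  exact: measurable_subr_exp.
move=> x _ /=; rewrite lee_fin [leRHS]ger0_norm; last first.
  by rewrite mulr_ge0 ?normal_pdf_ge0// divr_ge0// normal_peak_ge0.
rewrite ger0_norm; last by rewrite !mulr_ge0 ?expR_ge0 ?normal_pdf_ge0.
rewrite normal_pdf1E normal_pdfE// /normal_fun sqr_sqrtr// /C.
rewrite [leRHS]mulrA divfK; last first.
  by rewrite gt_eqF// normal_peak_gt0.
have -> : - (x - m0) ^+ 2 / (2 *+ 2) = - (x - m0) ^+ 2 / 2 + (x - m0) ^+ 2 / 4.
  by rewrite -mulr_natr; field.
rewrite expRD [leRHS]mulrA -[leLHS]mulrA ler_piMl//.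
  by rewrite !mulr_ge0 ?expR_ge0 ?normal_peak_ge0.
by case: (om x).
Qed.

(** Supplies the antiderivative for all the first-moment integrals. *)
Lemma is_derive_normal_pdf (m0 x : R) :
  is_derive x 1 (fun y => - normal_pdf m0 1 y) ((x - m0) * normal_pdf m0 1 x).
Proof.
rewrite normal_pdf1E; under eq_fun do rewrite normal_pdf1E.
pose g (y : R) := - (y - m0) ^+ 2 / 2.
have dg : is_derive x 1 g (- (x - m0)).
  rewrite (_ : g = (- 2^-1) \*: ((id - cst m0) ^+ 2)); last first.
    by apply/funext => y; rewrite /g !fctE -[RHS]/(- 2^-1 * (y - m0) ^+ 2); field.
  apply: is_derive_eq; rewrite !fctE/= subr0 expr1.
  by rewrite /GRing.scale/=; field.
have dh : is_derive x 1 (expR \o g) (- (x - m0) * expR (g x)).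
  rewrite [X in is_derive _ _ _ X]mulrC.
  by apply: is_derive1_comp.
rewrite (_ : (fun y => _) = (- normal_peak 1) \*: (expR \o g)); last first.
  by apply/funext => y; exact: (esym (mulNr (normal_peak 1) (expR (g y)))).
have -> : (x - m0) * (normal_peak 1 * expR (- (x - m0) ^+ 2 / 2)) =
    - normal_peak 1 *: (- (x - m0) * expR (g x)).
  by rewrite -[RHS]/(- normal_peak 1 * (- (x - m0) * expR (g x))); ring.
exact: is_deriveZ.
Qed.

Lemma continuous_first_moment (m0 : R) :
  continuous (fun x : R => (x - m0) * normal_pdf m0 1 x).
Proof.
move=> x; apply: cvgM; last exact: continuous_normal_pdf (oner_neq0 _) x.
by apply: cvgB; [exact: cvg_id|exact: cvg_cst].
Qed.

Lemma integral_first_moment_itv (m0 u v : R) : u < v ->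
  (\int[mu]_(x in `[u, v]) ((x - m0) * normal_pdf m0 1 x)%:E =
   (normal_pdf m0 1 u - normal_pdf m0 1 v)%:E)%E.
Proof.
move=> uv; pose F y := - normal_pdf m0 1 y.
have cF : continuous F.
  by move=> x; apply: cvgN; exact: continuous_normal_pdf (oner_neq0 _) x.
rewrite (@continuous_FTC2 _ _ F)//.
- by rewrite /F -EFinB opprK addrC.
- by apply: continuous_subspaceT; exact: continuous_first_moment.
- split.
  + by move=> x _; case: (is_derive_normal_pdf m0 x).
  + exact/cvg_at_right_filter/cF.
  + exact/cvg_at_left_filter/cF.
- by move=> x _; rewrite derive1E; case: (is_derive_normal_pdf m0 x).
Qed.

Lemma cvg_normal_pdfN (m0 : R) : normal_pdf m0 1 (- x) @[x --> +oo] --> (0 : R).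
Proof.
have h : normal_peak 1 * expR (- x) @[x --> +oo] --> (0 : R).
  by rewrite -[X in _ --> X](mulr0 (normal_peak 1)); apply: cvgMr; exact: cvgr_expR.
apply: squeeze_cvgr _ (cvg_cst 0) h; near=> x.
rewrite normal_pdf_ge0/= normal_pdf1E ler_wpM2l ?normal_peak_ge0// ler_expR.
(* Beyond this threshold [(x + m0) ^ 2 >= 2 * x], which places the density below the decaying
   exponential. *)
have : 2 + 3 * `|m0| <= x by near: x; exact: nbhs_pinfty_ge.
have := ler_norm m0; have := ler_norm (- m0); rewrite normrN => h1 h2 h3.
nra.
Unshelve. all: by end_near. Qed.

(** For [L < m0] the integrand has constant sign on the half-line. After a change of sign, the
    reflection [x -> - x] leads to a half-line towards [+oo], where the fundamental theorem for
    nonnegative functions applies. *)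
Lemma integral_first_moment_Ny (m0 L : R) : L < m0 ->
  (\int[mu]_(x in `]-oo, L]) ((x - m0) * normal_pdf m0 1 x)%:E =
   (- normal_pdf m0 1 L)%:E)%E.
Proof.
move=> Lm0.
pose f x := (m0 - x) * normal_pdf m0 1 x.
have cf : continuous f.
  rewrite (_ : f = fun x => - ((x - m0) * normal_pdf m0 1 x)).
    by move=> x; apply: cvgN; exact: continuous_first_moment.
  by apply/funext => x; rewrite /f -mulNr opprB.
have If : (\int[mu]_(x in `]-oo, L]) (f x)%:E = (normal_pdf m0 1 L)%:E)%E.
  rewrite -{1}(opprK L) ge0_integration_by_substitutionNy; last 2 first.
  - exact: continuous_subspaceT.
  - move=> x; rewrite in_itv/= opprK => xL.
    by rewrite /f mulr_ge0 ?normal_pdf_ge0// subr_ge0; lra.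
  pose F x := - normal_pdf m0 1 (- x).
  have dF (x : R) : is_derive x 1 F (f (- x)).
    have dN : is_derive (- x) 1 (fun y => - normal_pdf m0 1 y)
       ((- x - m0) * normal_pdf m0 1 (- x)) by exact: is_derive_normal_pdf.
    have -> : F = (fun y => - normal_pdf m0 1 y) \o -%R by [].
    have -> : f (- x) = (- x - m0) * normal_pdf m0 1 (- x) * -1 by rewrite /f; ring.
    exact: is_derive1_comp.
  have cF : continuous F.
    move=> x; case: (dF x) => + _.
    by move=> /derivable1_diffP/differentiable_continuous.
  rewrite (@ge0_continuous_FTC2y _ _ F _ 0).
  - by rewrite /F opprK -EFinB sub0r opprK.
  - by move=> x Lx; rewrite /f/= mulr_ge0 ?normal_pdf_ge0// subr_ge0; lra.
  - apply: continuous_subspaceT => x; apply: continuous_comp; last exact: cf.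
    exact: opp_continuous.
  - by rewrite -oppr0; apply: cvgN; exact: cvg_normal_pdfN.
  - by move=> x _; case: (dF x).
  - exact/cvg_at_right_filter/cF.
  - by move=> x _; rewrite derive1E; case: (dF x).
rewrite EFinN -If -integral_ge0N => [|x /=]; last first.
  rewrite in_itv/= => xL.
  by rewrite lee_fin /f mulr_ge0 ?normal_pdf_ge0// subr_ge0; lra.
by apply: eq_integral => x _; rewrite /f -EFinN -mulNr opprB.
Qed.

Lemma measurable_lt_indicator (B : R) : measurable_fun setT (fun x : R => (x < B)%R%:R : R).
Proof.
rewrite (_ : (fun x => _) = \1_(`]-oo, B[%classic : set R)); last first.
  by apply/funext => x; rewrite indicE mem_setE in_itv.
exact: measurable_indic.
Qed.

Lemma measurable_norm_le_indicator (B : R) :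
  measurable_fun setT (fun x : R => (`|x| <= B)%R%:R : R).
Proof.
rewrite (_ : (fun x => _) = \1_(`[- B, B]%classic : set R)); last first.
  by apply/funext => x; rewrite indicE mem_setE in_itv/= ler_norml.
exact: measurable_indic.
Qed.

Lemma truncated_normal_ge0 (m0 : R) (om : R -> bool) (x : R) :
  0 <= (om x)%:R * normal_pdf m0 1 x.
Proof. by rewrite mulr_ge0 ?normal_pdf_ge0. Qed.

Lemma measurable_truncated_normal (m0 : R) (om : R -> bool) :
  measurable_fun setT (fun x => (om x)%:R : R) ->
  measurable_fun setT (fun x => (om x)%:R * normal_pdf m0 1 x : R).
Proof. by move=> mom; apply: measurable_funM => //; exact: measurable_normal_pdf. Qed.

Lemma moment_indicatorE (m0 : R) (om : R -> bool) (D : set R) j :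
  (forall x, (x \in D) = om x) ->
  moment m0 (fun x => (om x)%:R * normal_pdf m0 1 x) j =
  \int[mu]_(x in D) ((x - m0) ^+ j * normal_pdf m0 1 x).
Proof.
move=> omD; rewrite Rintegral_mkcond; apply: eq_Rintegral => x _.
rewrite patchE omD; case: (om x); last by rewrite !mul0r.
by rewrite mul1r mulrC.
Qed.

Lemma integrable_first_moment (m0 : R) :
  mu.-integrable setT (EFin \o (fun x => (x - m0) * normal_pdf m0 1 x)).
Proof.
have mT : measurable_fun setT (fun x : R => (predT x)%:R : R) by exact: measurable_cst.
have := @integrable_moment R m0 (fun x => (predT x)%:R * normal_pdf m0 1 x)
  (truncated_normal_ge0 m0 predT) (measurable_truncated_normal m0 predT mT)
  (integrable_truncated_normal m0 predT mT) 1 isT.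
by rewrite (_ : (fun x => _ * _ * _) = (fun x => (x - m0) * normal_pdf m0 1 x))//;
  apply/funext => x; rewrite mul1r expr1 mulrC.
Qed.

Lemma moment1_lt (m0 B : R) :
  moment m0 (fun x => (x < B)%R%:R * normal_pdf m0 1 x) 1 = - std_pdf (B - m0).
Proof.
rewrite (moment_indicatorE _ _ `]-oo, B[%classic); last first.
  by move=> x; rewrite mem_setE in_itv.
under eq_Rintegral do rewrite expr1.
have iB (I : interval R) : mu.-integrable [set` I] (EFin \o (fun x => (x - m0) * normal_pdf m0 1 x)).
  by apply: (integrableS _ _ (subsetT _)) (integrable_first_moment m0); [|exact: measurable_itv].
rewrite Rintegral_itv_bndo_bndc; last exact: iB.
(* The cut lies strictly below [m0], as the tail formula requires, and strictly below [B]. The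
   density at [L] cancels between the tail and the compact piece. *)
pose L := Num.min m0 B - 1.
have Lm0 : L < m0.
  have : Num.min m0 B <= m0 by rewrite ge_min lexx.
  rewrite /L; lra.
have LB : L < B.
  have : Num.min m0 B <= B by rewrite ge_min lexx orbT.
  rewrite /L; lra.
have := @Rintegral_itvB R (fun x => (x - m0) * normal_pdf m0 1 x) -oo%O (BRight B) L (iB _)
   isT (ltW LB).
rewrite Rintegral_itv_obnd_cbnd; last exact: iB.
rewrite {2 3}/Rintegral integral_first_moment_Ny// integral_first_moment_itv//=.
by rewrite -!normal_pdf1_shift; lra.
Qed.

(** The translation [x -> x - m0] carries the integral to the standard normal one. *)
Lemma moment0_lt (m0 B : R) :
  moment m0 (fun x => (x < B)%R%:R * normal_pdf m0 1 x) 0 = std_cdf (B - m0).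
Proof.
rewrite (moment_indicatorE _ _ `]-oo, B[%classic); last first.
  by move=> x; rewrite mem_setE in_itv.
under eq_Rintegral do rewrite expr0 mul1r.
rewrite Rintegral_itv_bndo_bndc; last first.
  by apply: (integrableS _ _ (subsetT _)) (integrable_normal_pdf m0 1); [|exact: measurable_itv].
rewrite /std_cdf /Rintegral /normal_prob; congr fine.
pose F (x : R) := x - m0.
have dF (x : R) : is_derive x 1 F 1.
  by rewrite -[X in is_derive _ _ _ X]subr0; exact: is_deriveB.
have F'E : F^`()%classic = cst 1.
  by apply/funext => x; rewrite derive1E; case: (dF x).
have cF : continuous F.
  by move=> x; apply: cvgB; [exact: cvg_id|exact: cvg_cst].
rewrite (@increasing_ge0_integration_by_substitutionNy _ F).
- by apply: eq_integral => x _; rewrite F'E !fctE mulr1 !normal_pdf1E subr0.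
- by move=> x y _ _; rewrite /F ltrD2r.
- by rewrite F'E => x _; exact: cst_continuous.
- by rewrite F'E; exact: is_cvg_cst.
- by rewrite F'E; exact: cvg_cst.
- split; first by move=> x _; case: (dF x).
  exact/cvg_at_left_filter/cF.
- exact: cvg_addrr_Ny.
- by apply: continuous_subspaceT; exact: continuous_normal_pdf (oner_neq0 _).
- by move=> x _; exact: normal_pdf_ge0.
Qed.

(** By symmetry, the antiderivative takes equal values at [B] and [- B]. *)
Lemma moment1_norm_le (B : R) : 0 < B ->
  moment 0 (fun x => (`|x| <= B)%R%:R * normal_pdf 0 1 x) 1 = 0.
Proof.
move=> B0; rewrite (moment_indicatorE _ _ `[- B, B]%classic); last first.
  by move=> x; rewrite mem_setE in_itv/= ler_norml.
under eq_Rintegral do rewrite expr1.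
rewrite /Rintegral integral_first_moment_itv/= ?gtrN//.
by rewrite !normal_pdf1E !subr0 sqrrN subrr.
Qed.

(** The normal density is unimodal, so on [[u, v]] it is at least its smaller endpoint value [e].
    The moment is therefore at least [e * (v - u)]. *)
Lemma moment0_gt0 (m0 u v : R) (om : R -> bool) : u < v ->
  measurable_fun setT (fun x => (om x)%:R : R) ->
  (forall x, u <= x <= v -> om x) ->
  0 < moment m0 (fun x => (om x)%:R * normal_pdf m0 1 x) 0.
Proof.
move=> uv mom omuv.
pose e : R := Num.min (normal_pdf m0 1 u) (normal_pdf m0 1 v).
have e0 : 0 < e by rewrite lt_min !normal_pdf1_gt0.
have lb x : u <= x <= v -> e <= normal_pdf m0 1 x.
  move=> /andP[ux xv]; rewrite ge_min !normal_pdf1E.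
  rewrite !ler_pM2l ?normal_peak_gt0 ?oner_neq0// !ler_expR.
  by have [h|h] := leP x m0; apply/orP; [left|right]; nra.
have iw := integrable_moment m0 _ (truncated_normal_ge0 m0 om)
  (measurable_truncated_normal m0 om mom) (integrable_truncated_normal m0 om mom) 0 isT.
apply: (@lt_le_trans _ _ (\int[mu]_x (e * \1_(`[u, v]%classic) x))).
  rewrite /Rintegral.
  under eq_integral do rewrite EFinM.
  rewrite integralZl//; last exact: integrable_indic_itv.
  rewrite integral_indic//= setIT lebesgue_measure_itv/= lte_fin uv -EFinD -EFinM/=.
  by rewrite mulr_gt0// subr_gt0.
apply: le_Rintegral => //.
- rewrite (_ : _ \o _ = (fun x => e%:E * (EFin \o \1_(`[u, v]%classic)) x))%E//.
  by apply: integrableZl => //; exact: integrable_indic_itv.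
- move=> x _; rewrite indicE mem_setE in_itv/= expr0 mulr1.
  have [h|h] := boolP (u <= x <= v); last by rewrite mulr0 truncated_normal_ge0.
  by rewrite omuv// mulr1 mul1r lb.
Qed.

End gaussian_moments.

(** * Composable differentiation rules *)

Section derivative_rules.
Context {R : realType}.
Implicit Types (f g : R -> R) (x df dg : R).

(** This rule and the next ones are phrased for explicit [fun c => ...], so that a derivative is
    built as a proof term and only an equation between values remains. *)
Lemma is_derive1_add f g x df dg : is_derive x 1 f df -> is_derive x 1 g dg ->
  is_derive x 1 (fun c => f c + g c) (df + dg).
Proof. by move=> hf hg; exact: is_deriveD. Qed.

Lemma is_derive1_sub f g x df dg : is_derive x 1 f df -> is_derive x 1 g dg ->
  is_derive x 1 (fun c => f c - g c) (df - dg).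
Proof. by move=> hf hg; exact: is_deriveB. Qed.

Lemma is_derive1_mul f g x df dg : is_derive x 1 f df -> is_derive x 1 g dg ->
  is_derive x 1 (fun c => f c * g c) (f x * dg + g x * df).
Proof. by move=> hf hg; exact: is_deriveM. Qed.

Lemma is_derive1_scale k f x df : is_derive x 1 f df ->
  is_derive x 1 (fun c => k * f c) (k * df).
Proof. by move=> hf; exact: is_deriveZ. Qed.

Lemma is_derive1_exp n f x df : is_derive x 1 f df ->
  is_derive x 1 (fun c => f c ^+ n) (n%:R * f x ^+ n.-1 * df).
Proof.
move=> hf; rewrite (_ : (fun c => _) = f ^+ n); first exact: is_deriveX.
by apply/funext => c; rewrite fctE.
Qed.

Lemma is_derive1_inv f x df : f x != 0 -> is_derive x 1 f df ->
  is_derive x 1 (fun c => (f c)^-1) (- (f x) ^- 2 * df).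
Proof.
move=> fx [hf <-]; apply: DeriveDef; first exact: derivableV.
by rewrite deriveV.
Qed.

Lemma is_derive1_affine (k l x : R) : is_derive x 1 (fun c => k + l * c) l.
Proof.
rewrite -[X in is_derive _ _ _ X]add0r; apply: is_derive1_add.
by rewrite -[X in is_derive _ _ _ X]mulr1; exact: is_derive1_scale.
Qed.

Lemma is_derive1_ln_comp (d : R -> R) x dd : 0 < d x -> is_derive x 1 d dd ->
  is_derive x 1 (fun c => ln (d c)) ((d x)^-1 * dd).
Proof. by move=> dx hd; have := is_derive1_ln dx => ?; exact: is_derive1_comp. Qed.

Lemma is_derive_near_gt0 f x df : is_derive x 1 f df -> 0 < f x ->
  \forall c \near x, 0 < f c.
Proof.
move=> [/derivable1_diffP/differentiable_continuous cf _] fx.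
exact: (cvgr_gt (f x) cf).
Qed.

Lemma is_derive_increase f df (e : R) : is_derive (0 : R) 1 f df -> 0 < df -> 0 < e ->
  exists c, 0 < c < e /\ f 0 < f c.
Proof.
move=> [hf hdf] df0 e0.
have cf : (fun h => h^-1 *: ((f \o shift 0) (h *: 1) - f 0)) @ (0 : R)^' --> df.
  by rewrite -[X in _ --> X]hdf; exact: hf.
have : \forall h \near (0 : R)^', 0 < h^-1 *: ((f \o shift 0) (h *: 1) - f 0).
  exact: (cvgr_gt df cf).
move=> [r /= r0 H].
(* Half the minimum is nonzero, inside the radius [r] where the quotient is positive, and below
   [e]. *)
have c0 : 0 < Num.min r e / 2 by rewrite divr_gt0// lt_min r0.
have cr : Num.min r e / 2 < Num.min r e by lra.
exists (Num.min r e / 2); split.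
  by rewrite c0/=; apply: (lt_le_trans cr); rewrite ge_min lexx orbT.
have := H (Num.min r e / 2).
rewrite /= sub0r normrN gtr0_norm// addr0 [_ *: 1]mulr1.
have crr : Num.min r e / 2 < r by apply: (lt_le_trans cr); rewrite ge_min lexx.
move=> /(_ crr) /(_ (lt0r_neq0 c0)).
by rewrite pmulr_rgt0 ?invr_gt0// subr_gt0.
Qed.

End derivative_rules.

(** * Derivative of a product-event probability at the identity covariance *)

Section mvn_derivative.
Context {R : realType}.

(** With [p = - r] the coefficients of the squares cancel, so the second moment drops out. The
    [m * (m - 1)] ordered pairs of distinct indices remain, each contributing the square of the
    ratio of the first two moments. *)
Lemma perturb_linear_cross m (m0 : R) w (b t : R) : moment m0 w 0 != 0 ->
  perturb_linear m m0 w 0 (- b / 2) t (b / 2) - moment m0 w 0 ^+ m =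
  moment m0 w 0 ^+ m * (t * m%:R * (moment m0 w 1 / moment m0 w 0)
    - b / 2 * (m%:R * (m%:R - 1)) * (moment m0 w 1 / moment m0 w 0) ^+ 2).
Proof.
set M := moment m0 w => M0.
pose rho := M 1 / M 0.
have prodE (e : 'I_m -> nat) : (forall l, e l <= 1)%N ->
    \prod_(l < m) M (e l) = M 0 ^+ m * rho ^+ (\sum_(l < m) e l).
  have -> : M 0 ^+ m = \prod_(l < m) M 0 by rewrite prodr_const card_ord.
  move=> e1; rewrite -prodrXr -big_split/=.
  apply: eq_bigr => l _; have := e1 l.
  case: (e l) => [|[|]]// _; first by rewrite expr0 mulr1.
  by rewrite expr1 /rho mulrC divfK.
have sum1 (i : 'I_m) : (\sum_(l < m) (l == i))%N = 1.
  by rewrite (bigD1 i)//= eqxx big1// => l /negbTE ->.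
have P1 i : \prod_(l < m) M (l == i) = M 0 ^+ m * rho.
  by rewrite (prodE (fun l => nat_of_bool (l == i)))=> [|l]; rewrite ?sum1 ?expr1 ?leq_b1.
have P2 i j : i != j -> \prod_(l < m) M ((l == i) + (l == j))%N = M 0 ^+ m * rho ^+ 2.
  move=> ij; rewrite (prodE (fun l => (l == i) + (l == j)))%N => [|l].
    by rewrite big_split/= !sum1.
  by case: eqP => [->|_]; rewrite ?(negbTE ij) ?leq_b1.
rewrite /perturb_linear -/M addrC addKr mul0r add0r.
under eq_bigr do rewrite P1.
have -> : \sum_(i < m) \sum_(j < m) - (- b / 2 * (i == j)%:R + b / 2) *
    \prod_(l < m) M ((l == i) + (l == j))%N =
    \sum_(i < m) \sum_(j < m) - (b / 2) * (M 0 ^+ m * rho ^+ 2) * (1 - (i == j)%:R).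
  apply: eq_bigr => i _; apply: eq_bigr => j _.
  have [->|ij] := eqVneq i j; first by rewrite subrr mulr0 mulr1 !mulNr addNr mul0r oppr0.
  by rewrite P2// mulr0 add0r subr0 mulr1.
have -> : \sum_(i < m) \sum_(j < m) - (b / 2) * (M 0 ^+ m * rho ^+ 2) * (1 - (i == j)%:R) =
   - (b / 2) * (M 0 ^+ m * rho ^+ 2) * (m%:R * (m%:R - 1)).
  under eq_bigr do rewrite -mulr_sumr sumrB sumr_const card_ord.
  rewrite -mulr_sumr sumrB sumr_const card_ord -/rho; congr (_ * _).
  under eq_bigr do rewrite -natr_sum.
  have -> : \sum_(i < m) (\sum_(j < m) (i == j))%:R = m%:R :> R.
    under eq_bigr do (under eq_bigr do rewrite eq_sym); under eq_bigr do rewrite sum1.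
    by rewrite sumr_const card_ord.
  by rewrite mulrBr mulr1 mulr_natr.
rewrite sumr_const card_ord -/rho -mulr_natr; ring.
Qed.

(* The variances are stationary at [c = 0] exactly when [da = - db], so that only
   the drift [dt] of the mean and the pairwise correlations contribute. *)
Lemma is_derive_mvn_prob m (m0 : R) (om : R -> bool) (a b t d : R -> R) (db dt : R)
    (Sig : R -> 'M[R]_m) (H : R -> R)
    (M := moment m0 (fun x => (om x)%:R * normal_pdf m0 1 x)) :
  measurable_fun setT (fun x => (om x)%:R : R) -> M 0 != 0 ->
  is_derive (0 : R) 1 a (- db) -> is_derive (0 : R) 1 b db ->
  is_derive (0 : R) 1 t dt -> is_derive (0 : R) 1 d 0 ->
  a 0 = 1 -> b 0 = 0 -> t 0 = m0 -> d 0 = 1 ->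
  (\forall c \near (0 : R), [/\
     H c = mvn_prob R m (const_mx (t c)) (Sig c) (fun x => [forall i, om (x i 0)]),
     \det (Sig c) = d c & invmx (Sig c) = (a c)%:M + b c *: const_mx 1]) ->
  H 0 = M 0 ^+ m /\
  is_derive (0 : R) 1 H (M 0 ^+ m * (dt * m%:R * (M 1 / M 0)
    - db / 2 * (m%:R * (m%:R - 1)) * (M 1 / M 0) ^+ 2)).
Proof.
move=> mom M0 ha hb ht hd a0 b0 t0 d0 HS.
(* These are the four coefficients that [mvn_probE] assigns to the exponent. *)
pose s c := - ln (d c) / 2 - (a c * m%:R + b c * m%:R ^+ 2) * (t c - m0) ^+ 2 / 2.
pose p c := (a c - 1) / 2.
pose q c := (a c + b c * m%:R) * (t c - m0).
pose r c := b c / 2.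
have s0 : s 0 = 0 by rewrite /s d0 t0 ln1 subrr; ring.
have p0 : p 0 = 0 by rewrite /p a0; ring.
have q0 : q 0 = 0 by rewrite /q t0; ring.
have r0 : r 0 = 0 by rewrite /r b0; ring.
have hT : is_derive (0 : R) 1 (fun c => t c - m0) dt.
  by rewrite -[X in is_derive _ _ _ X]subr0; exact: is_derive1_sub.
have hQ : is_derive (0 : R) 1 (fun c => a c + b c * m%:R) (- db + db * m%:R).
  rewrite mulrC; apply: is_derive1_add => //.
  under eq_fun do rewrite mulrC; exact: is_derive1_scale.
have hp : is_derive (0 : R) 1 p (- db / 2).
  rewrite -[X in is_derive _ _ _ X]mulrC /p; under eq_fun do rewrite mulrC.
  by apply: is_derive1_scale; rewrite -[- db]subr0; exact: is_derive1_sub.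
have hq : is_derive (0 : R) 1 q dt.
  apply: (is_derive_eq (is_derive1_mul _ _ _ _ _ hQ hT)).
  by rewrite a0 b0 t0; ring.
have hr : is_derive (0 : R) 1 r (db / 2).
  by rewrite mulrC /r; under eq_fun do rewrite mulrC; exact: is_derive1_scale.
(* The determinant is stationary at 0, and [(t c - m0) ^ 2] vanishes there to second order. *)
have hs : is_derive (0 : R) 1 s 0.
  pose s' c := - 2^-1 * ln (d c) - 2^-1 * ((a c * m%:R + b c * m%:R ^+ 2) * (t c - m0) ^+ 2).
  rewrite (_ : s = s'); last by apply/funext => c; rewrite /s /s'; field.
  have hA : is_derive (0 : R) 1 (fun c => a c * m%:R + b c * m%:R ^+ 2)
      (m%:R * - db + m%:R ^+ 2 * db).
    by apply: is_derive1_add; under eq_fun do rewrite mulrC; exact: is_derive1_scale.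
  have hd0 : 0 < d 0 by rewrite d0.
  apply: (is_derive_eq (is_derive1_sub _ _ _ _ _
    (is_derive1_scale _ _ _ _ (is_derive1_ln_comp _ _ _ hd0 hd))
    (is_derive1_scale _ _ _ _ (is_derive1_mul _ _ _ _ _ hA (is_derive1_exp 2 _ _ _ hT))))).
  by rewrite t0 d0; ring.
(* The identification holds only near 0, where the determinant stays positive. That suffices for
   both the value and the derivative at 0. *)
have HE : \forall c \near (0 : R),
   perturbed_integral m m0 (fun x => (om x)%:R * normal_pdf m0 1 x) (s c) (p c) (q c) (r c)
   = H c.
  have := is_derive_near_gt0 _ _ _ hd; rewrite d0 => /(_ ltr01) dgt0.
  near=> c.
  have [-> dS iS] : [/\
     H c = mvn_prob R m (const_mx (t c)) (Sig c) (fun x => [forall i, om (x i 0)]),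
     \det (Sig c) = d c & invmx (Sig c) = (a c)%:M + b c *: const_mx 1] by near: c.
  by rewrite (@mvn_probE R m (t c) m0 (a c) (b c) (d c))//; near: c.
split.
  by rewrite -(nbhs_singleton HE) s0 p0 q0 r0 perturbed_integral0//;
    [exact: truncated_normal_ge0|exact: measurable_truncated_normal|
     exact: integrable_truncated_normal].
apply: near_eq_is_derive HE _; rewrite -perturb_linear_cross//.
by apply: is_derive_perturbed_integral => //;
  [exact: truncated_normal_ge0|exact: measurable_truncated_normal|
     exact: integrable_truncated_normal].
Unshelve. all: by end_near. Qed.

End mvn_derivative.

(** * The sign and inclusion probabilities near [c = 0] *)

Section selection_probabilities.
Context {R : realType} (n p : nat) (lam beta : R) (A : {set 'I_p}).
Context (n_gt0 : (0 < n)%N) (lam_gt0 : 0 < lam) (beta_gt0 : 0 < beta).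

Local Notation rn := (Num.sqrt (n%:R : R)).
Local Notation K := (#|A|%:R : R).
Local Notation m := (#|~: A|%:R : R).

Lemma subm_Cmat_diag c (X : {set 'I_p}) :
  subm R p (Cmat R p c) X X = (1 - c)%:M + c *: const_mx 1.
Proof. by apply/matrixP => i j; rewrite !mxE (inj_eq enum_val_inj). Qed.

Lemma subm_Cmat_disjoint c (X Y : {set 'I_p}) : (forall x, x \in X -> x \notin Y) ->
  subm R p (Cmat R p c) X Y = c *: const_mx 1.
Proof.
move=> XY; apply/matrixP => i j; rewrite !mxE.
case: eqP => [ij|_]; last by rewrite mulr0n add0r.
by have := XY _ (enum_valP i); rewrite ij enum_valP.
Qed.

Lemma invmx_Cmat c : 1 - c != 0 -> 1 + (K - 1) * c != 0 ->
  invmx (subm R p (Cmat R p c) A A) =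
  (1 - c)^-1%:M + (- c / ((1 - c) * (1 + (K - 1) * c))) *: const_mx 1.
Proof.
move=> c1 c2; rewrite subm_Cmat_diag; apply: invmx_equicor; first by rewrite divff.
by field; rewrite c1 c2.
Qed.

(** The row sum of the inverse is what drives the means of both Gaussian vectors. *)
Lemma invmx_Cmat_rowsum c : 1 - c != 0 -> 1 + (K - 1) * c != 0 ->
  (1 - c)^-1 + - c / ((1 - c) * (1 + (K - 1) * c)) * K = (1 + (K - 1) * c)^-1.
Proof. by move=> c1 c2; field; rewrite c1 c2. Qed.

Lemma near0_affine_gt0 (l : R) : \forall c \near (0 : R), 0 < 1 + l * c.
Proof.
apply: (is_derive_near_gt0 _ _ _ (is_derive1_affine 1 l 0)).
by rewrite mulr0 addr0.
Qed.

Lemma is_derive_onem : is_derive (0 : R) 1 (fun c => 1 - c) (- 1).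
Proof. by rewrite -[X in is_derive _ _ _ X]sub0r; exact: is_derive1_sub. Qed.

(** The precision matrix is here the submatrix of [Cmat] itself, so [a = 1 - c] and [b = c]. The
    mean drifts at rate [- m0 * (K - 1)] and the moment ratio is [- rho]; drift and correlation thus
    contribute terms of opposite sign. *)
Lemma PS_derivative (tau := rn * (beta - lam)) (rho := std_pdf tau / std_cdf tau) :
  0 < std_cdf tau /\
  is_derive (0 : R) 1 (fun c => PS R n p lam c A (const_mx beta))
    (std_cdf tau ^+ #|A| * (K * (K - 1) / 2 * rho * (2 * (lam * rn) - rho))).
Proof.
pose om (x : R) := x < rn * beta.
pose m0 := lam * rn.
have mom : measurable_fun setT (fun x => (om x)%:R : R) by exact: measurable_lt_indicator.
have tauE : rn * beta - m0 = tau by rewrite /m0 /tau; ring.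
have M0 : moment m0 (fun x => (om x)%:R * normal_pdf m0 1 x) 0 = std_cdf tau.
  by rewrite moment0_lt tauE.
have M1 : moment m0 (fun x => (om x)%:R * normal_pdf m0 1 x) 1 = - std_pdf tau.
  by rewrite moment1_lt tauE.
have G0 : 0 < std_cdf tau.
  rewrite -M0; apply: (moment0_gt0 m0 (rn * beta - 2) (rn * beta - 1)) => //; first by lra.
  by move=> x; rewrite /om; lra.
split=> //.
(* The covariance is an inverse, hence the reciprocal of [det_equicor]. At 0 the two factors have
   derivatives [- K] and [K], which cancel. *)
pose d c := ((1 - c) ^+ #|A| * (1 + K * (c * (1 - c)^-1)))^-1 : R.
have one0 : 1 - 0 != 0 :> R by rewrite subr0 oner_eq0.
have hd : is_derive (0 : R) 1 d 0.
  have hid := is_derive_id (0 : R) (1 : R).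
  have h1 := is_derive1_mul _ _ _ _ _ hid (is_derive1_inv (fun c => 1 - c) _ _ one0 is_derive_onem).
  have h2 := is_derive1_add _ _ _ _ _ (is_derive_cst (1 : R) (0 : R) (1 : R))
    (is_derive1_scale K _ _ _ h1).
  have h3 := is_derive1_mul _ _ _ _ _ (is_derive1_exp #|A| _ _ _ is_derive_onem) h2.
  apply: (is_derive_eq (is_derive1_inv _ _ _ _ h3)).
    by rewrite /= mul0r mulr0 addr0 mulr1 expf_neq0.
  rewrite /= subr0 !expr1n invr1 mul0r mulr0; ring.
pose t c := m0 * (1 + (K - 1) * c)^-1.
have ht : is_derive (0 : R) 1 t (- (m0 * (K - 1))).
  have nz : 1 + (K - 1) * 0 != 0 :> R by rewrite mulr0 addr0 oner_eq0.
  apply: (is_derive_eq (is_derive1_scale m0 _ _ _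
    (is_derive1_inv (fun c => 1 + (K - 1) * c) _ _ nz (is_derive1_affine 1 (K - 1) 0)))).
  by rewrite mulr0 addr0 expr1n invr1; ring.
have M0n : moment m0 (fun x => (om x)%:R * normal_pdf m0 1 x) 0 != 0.
  by rewrite M0 gt_eqF.
have := @is_derive_mvn_prob R #|A| m0 om (fun c => 1 - c) id t d 1 (- (m0 * (K - 1)))
  (fun c => invmx (subm R p (Cmat R p c) A A)) (fun c => PS R n p lam c A (const_mx beta))
  mom M0n is_derive_onem (is_derive_id _ _) ht hd.
case.
- by rewrite subr0.
- by [].
- by rewrite /t mulr0 addr0 invr1 mulr1.
- by rewrite /d subr0 expr1n !mul0r mulr0 addr0 mulr1 invr1.
- near=> c.
  have c1 : 0 < 1 - c.
    have : 0 < 1 + -1 * c by near: c; exact: near0_affine_gt0.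
    lra.
  have c2 : 0 < 1 + (K - 1) * c by near: c; exact: near0_affine_gt0.
  have c1' : 1 - c != 0 by rewrite gt_eqF.
  have c2' : 1 + (K - 1) * c != 0 by rewrite gt_eqF.
  split.
  + rewrite /PS.
    have -> : map_mx (fun x => Num.sg x) (const_mx beta) = const_mx 1 :> 'cV[R]_#|A|.
      by apply/matrixP => i j; rewrite !mxE gtr0_sg.
    have -> : diag_mx (const_mx 1 : 'cV[R]_#|A|)^T = 1%:M.
      by rewrite trmx_const diag_const_mx.
    rewrite !mul1mx mulmx1.
    have -> : lam * rn *: (invmx (subm R p (Cmat R p c) A A) *m const_mx 1) =
        const_mx (t c) :> 'cV[R]_#|A|.
      rewrite invmx_Cmat// mul_equicor_const invmx_Cmat_rowsum// scalerA.
      by apply/matrixP => i j; rewrite !mxE mulr1.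
    have -> : rn *: const_mx beta = const_mx (rn * beta) :> 'cV[R]_#|A|.
      by apply/matrixP => i j; rewrite !mxE.
    suff -> : (fun u : 'cV[R]_#|A| => [forall i, u i 0 < (const_mx (rn * beta) : 'cV[R]_#|A|) i 0])
        = (fun u => [forall i, om (u i 0)]) by [].
    by apply/funext => u; apply: eq_forallb => i; rewrite mxE.
  + rewrite det_inv subm_Cmat_diag det_equicor// /d; congr (_ * (_ + _))^-1.
    by rewrite mulrA.
  + by rewrite invmxK subm_Cmat_diag.
move=> _; rewrite M0 M1 => h; apply: (is_derive_eq h).
congr (_ * _); rewrite /rho /m0; set G := std_cdf tau; field.
by rewrite gt_eqF.
Unshelve. all: by end_near. Qed.

(** At [c = 0] the vector is centred and the truncation is symmetric, so the first moment is 0. The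
    drift and correlation terms both carry it as a factor. *)
Lemma PI_derivative :
  0 < PI R n p lam 0 A (const_mx 1) /\
  is_derive (0 : R) 1 (fun c => PI R n p lam c A (const_mx 1)) 0.
Proof.
pose om (x : R) := `|x| <= lam * rn.
have lr0 : 0 < lam * rn by rewrite mulr_gt0// sqrtr_gt0 ltr0n.
have mom : measurable_fun setT (fun x => (om x)%:R : R).
  exact: measurable_norm_le_indicator.
have M1 : moment 0 (fun x => (om x)%:R * normal_pdf 0 1 x) 1 = 0.
  exact: moment1_norm_le.
have M0 : 0 < moment 0 (fun x => (om x)%:R * normal_pdf 0 1 x) 0.
  apply: (moment0_gt0 0 0 (lam * rn)) => // x /andP[x0 xl].
  by rewrite /om ger0_norm.
(* The conditional covariance is [(1 - c) I + bS J]. Its precision is a block of the inverse of the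
   full equicorrelation matrix of size [K + m], which explains the form of [b]. *)
pose bS c := c - c ^+ 2 * (K * (1 + (K - 1) * c)^-1) : R.
pose d c := (1 - c) ^+ #|~: A| * (1 + m * (bS c * (1 - c)^-1)) : R.
pose b c := - (c * ((1 - c) * (1 + (K + m - 1) * c))^-1) : R.
pose t c := lam * rn * (K * (c * (1 + (K - 1) * c)^-1)).
have one0 : 1 - 0 != 0 :> R by rewrite subr0 oner_eq0.
have nz (l : R) : 1 + l * 0 != 0 :> R by rewrite mulr0 addr0 oner_eq0.
have hid := is_derive_id (0 : R) (1 : R).
have hinv (l : R) := is_derive1_inv (fun c => 1 + l * c) _ _ (nz l) (is_derive1_affine 1 l 0).
have hinv1 := is_derive1_inv (fun c => 1 - c) _ _ one0 is_derive_onem.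
have hbS : is_derive (0 : R) 1 bS 1.
  apply: (is_derive_eq (is_derive1_sub _ _ _ _ _ hid
   (is_derive1_mul _ _ _ _ _ (is_derive1_exp 2 _ _ _ hid)
     (is_derive1_scale K _ _ _ (hinv (K - 1)))))).
  by rewrite /= expr0n/=; ring.
have hd : is_derive (0 : R) 1 d 0.
  apply: (is_derive_eq (is_derive1_mul _ _ _ _ _ (is_derive1_exp #|~: A| _ _ _ is_derive_onem)
   (is_derive1_add _ _ _ _ _ (is_derive_cst (1 : R) (0 : R) (1 : R))
    (is_derive1_scale m _ _ _ (is_derive1_mul _ _ _ _ _ hbS hinv1))))).
  by rewrite /= /bS subr0 !expr1n invr1 expr0n/=; ring.
have hb : is_derive (0 : R) 1 b (- 1).
  have nz' : (1 - 0) * (1 + (K + m - 1) * 0) != 0 :> R by rewrite mulf_neq0.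
  have h := is_derive1_mul _ _ _ _ _ hid (is_derive1_inv (fun c => (1 - c) * (1 + (K + m - 1) * c)) _ _ nz'
    (is_derive1_mul _ _ _ _ _ is_derive_onem (is_derive1_affine 1 (K + m - 1) 0))).
  have h' := is_derive1_scale (-1) _ _ _ h.
  rewrite (_ : b = fun c => -1 * (c * ((1 - c) * (1 + (K + m - 1) * c))^-1)); last first.
    by apply/funext => c; rewrite /b mulN1r.
  apply: (is_derive_eq h').
  by rewrite /= !(subr0, mul0r, mulr0, addr0, add0r, mulr1, invr1).
have ha : is_derive (0 : R) 1 (fun c => (1 - c)^-1) (- - 1).
  by apply: (is_derive_eq hinv1); rewrite subr0 expr1n invr1; ring.
have ht : is_derive (0 : R) 1 t (lam * rn * K).
  apply: (is_derive_eq (is_derive1_scale (lam * rn) _ _ _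
    (is_derive1_scale K _ _ _ (is_derive1_mul _ _ _ _ _ hid (hinv (K - 1)))))).
  by rewrite /= mulr0 addr0 invr1; ring.
have := @is_derive_mvn_prob R #|~: A| 0 om (fun c => (1 - c)^-1) b t d (- 1) (lam * rn * K)
  (fun c => (1 - c)%:M + bS c *: const_mx 1) (fun c => PI R n p lam c A (const_mx 1))
  mom (lt0r_neq0 M0) ha hb ht hd.
case.
- by rewrite subr0 invr1.
- by rewrite /b mul0r oppr0.
- by rewrite /t mul0r !mulr0.
- by rewrite /d /bS expr0n/= !(mul0r, subr0, mulr0, addr0, mulr1) expr1n.
- near=> c.
  have c1 : 0 < 1 - c.
    have : 0 < 1 + -1 * c by near: c; exact: near0_affine_gt0.
    lra.
  have c2 : 0 < 1 + (K - 1) * c by near: c; exact: near0_affine_gt0.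
  have c3 : 0 < 1 + (K + m - 1) * c by near: c; exact: near0_affine_gt0.
  have c1' : 1 - c != 0 by rewrite gt_eqF.
  have c2' : 1 + (K - 1) * c != 0 by rewrite gt_eqF.
  have c3' : 1 + (K + m - 1) * c != 0 by rewrite gt_eqF.
  split.
  + have dI x : x \in ~: A -> x \notin A by rewrite inE.
    have dA x : x \in A -> x \notin ~: A by rewrite inE negbK.
    rewrite /PI (subm_Cmat_disjoint c (~: A) A dI) (subm_Cmat_disjoint c A (~: A) dA).
    rewrite (subm_Cmat_diag c (~: A)).
    rewrite -!mulmxA.
    rewrite invmx_Cmat// -scalemxAr !mul_equicor_const invmx_Cmat_rowsum//.
    set v := (X in mvn_prob _ _ X); have -> : v = const_mx (t c).
      apply/matrixP => i j; rewrite /v -scalemxAl -scalemxAr mul_const_mx1 !mxE /t.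
      by field.
    set S := (X in mvn_prob _ _ _ X); suff -> : S = (1 - c)%:M + bS c *: const_mx 1 by [].
    rewrite /S -scalemxAl -!scalemxAr mul_const_mx1 -addrA; congr (_ + _).
    rewrite !scalerA -scalerBl; congr (_ *: _); rewrite /bS; field.
    exact: c2'.
  + by rewrite det_equicor// /d mulrA.
  + rewrite /b; apply: invmx_equicor; first by rewrite divff.
    by rewrite /bS; field; rewrite c1' c2' c3'.
move=> -> ; rewrite M1 mul0r expr0n/= => h; split; first by rewrite exprn_gt0.
by apply: (is_derive_eq h); ring.
Unshelve. all: by end_near. Qed.

End selection_probabilities.

(** * Positivity of the derivative of the criterion, and local increase *)

Theorem theorem2 (R : realType) (n p k : nat) (lam beta : R) (A : {set 'I_p}) :
  (1 <= n)%N -> (2 <= k)%N -> (k < p)%N -> 0 < beta -> 0 < lam -> #|A| = k ->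
  2 * (lam * Num.sqrt n%:R) >
    std_pdf (Num.sqrt n%:R * (beta - lam)) / std_cdf (Num.sqrt n%:R * (beta - lam)) ->
  (derivable (psi n p lam beta A) 0 1 /\ 0 < derive1 (psi n p lam beta A) 0) /\
  (exists c : R, 0 < c < 1 /\ psi n p lam beta A c > psi n p lam beta A 0).
Proof.
move=> n1 k2 _ beta0 lam0 Ak cond.
have [G0 dPS] := PS_derivative n p lam beta A beta0.
have [PI0 dPI] := PI_derivative n p lam A n1 lam0.
set dS := (_ * _) in dPS.
have dS0 : 0 < dS.
  rewrite /dS; apply: mulr_gt0; first by rewrite exprn_gt0.
  (* The hypothesis on [lam] makes the last factor positive; [k >= 2] makes [K * (K - 1)]
     positive. *)
  apply: mulr_gt0; last by rewrite subr_gt0.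
  apply: mulr_gt0; last by rewrite divr_gt0// normal_pdf1_gt0.
  have A2 : (1 < #|A|)%N by rewrite Ak.
  by rewrite divr_gt0// mulr_gt0// ?subr_gt0 ?ltr1n// ltr0n ltnW.
(* In the product rule, the term with the derivative of [PI] is zero. *)
have dpsi : is_derive (0 : R) 1 (psi n p lam beta A) (PI R n p lam 0 A (const_mx 1) * dS).
  apply: (is_derive_eq (is_derive1_mul _ _ _ _ _ dPS dPI)).
  by move: (PS _ _ _ _ _ _ _) (PI _ _ _ _ _ _ _) => u v; rewrite mulr0 add0r.
have dpsi0 : 0 < PI R n p lam 0 A (const_mx 1) * dS by rewrite mulr_gt0.
(* The bound 1 keeps the witness in the range of admissible correlations. *)
split; last by have [c []] := is_derive_increase _ _ 1 dpsi dpsi0 ltr01; exists c.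
case: dpsi => dv vE; split=> //.
by rewrite derive1E vE.
Qed.
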